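(* Let $n\ge1$ and let $A_1,\dots,A_n\in M_3(\mathbb{C})$ be pairwise commuting contractions, each of the form scalar plus nilpotent of order 2, i.e. $A_i=\lambda_iI+N_i$ with $\lambda_i\in\mathbb{C}$ and $N_i^2=0$. Then $A_1,\dots,A_n$ satisfy the scalar von Neumann inequality: for every complex polynomial $p$ in $n$ variables, $$\|p(A_1,\dots,A_n)\|\le\|p\|_\infty:=\sup\{|p(z_1,\dots,z_n)|: z_i\in\mathbb{C},\ |z_i|\le1 \text{ for } 1\le i\le n\}.$$
   Context: Matrices carry the operator norm on $\mathbb{C}^3$ with its standard inner product; a contraction is a matrix of operator norm at most $1$. A nilpotent of order 2 means a matrix $N$ with $N^2=0$ (the zero matrix is allowed). *)

(* Defs.v *)
From mathcomp Require Import all_boot all_order all_algebra.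
From mathcomp Require Import complex mpoly.
From mathcomp Require Import classical_sets reals.

Set Implicit Arguments.
Unset Strict Implicit.
Unset Printing Implicit Defensive.

Import Order.TTheory GRing.Theory Num.Theory.
Import Normc.

Local Open Scope classical_set_scope.
Local Open Scope ring_scope.

Section Norms.
Variable R : realType.
Local Notation C := R[i].

Definition l2norm k (x : 'cV[C]_k) : R :=
  Num.sqrt (\sum_i normc (x i 0) ^+ 2).

(* [sup] is real-valued and defaults to 0 on sets without a supremum;
   [has_sup_opnorm] and [has_sup_supnorm] show that this never happens here. *)
Definition opnorm k (A : 'M[C]_k) : R :=
  sup [set l2norm (A *m x) | x in [set x : 'cV[C]_k | l2norm x <= 1]].

Definition contraction k (A : 'M[C]_k) : Prop := opnorm A <= 1.

Definition scalar_plus_nilpotent2 k (A : 'M[C]_k) : Prop :=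
  exists (lambda : C) (N : 'M[C]_k), N *m N = 0 /\ A = lambda%:M + N.

Definition polydisc n : set ('I_n -> C) :=
  [set z | forall i, normc (z i) <= 1].

Definition supnorm n (p : {mpoly C[n]}) : R :=
  sup [set normc p.@[z] | z in @polydisc n].

(* [meval] only evaluates in the coefficient ring. The order of the factors in
   the noncommutative product [mmap1] is immaterial for commuting matrices. *)
Definition mxeval n k (p : {mpoly C[n]}) (A : 'I_n -> 'M[C]_k.+1) :
  'M[C]_k.+1 := mmap (@scalar_mx C k.+1) A p.

Lemma normc_ge0 (z : C) : 0 <= normc z.
Proof. by case: z => a b; exact: sqrtr_ge0. Qed.

Lemma l2norm0 k : l2norm (0 : 'cV[C]_k) = 0.
Proof.
rewrite /l2norm big1 ?sqrtr0// => i _.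
by rewrite mxE /normc /= !expr0n /= addr0 sqrtr0 expr0n.
Qed.

Lemma l2norm_dot k (x : 'cV[C]_k) :
  ((l2norm x ^+ 2)%:C)%C = \sum_i x i 0 * (x i 0)^*%C.
Proof.
rewrite sqr_sqrtr ?sumr_ge0// => [|i _]; last exact: sqr_ge0.
rewrite rmorph_sum; apply: eq_bigr => i _ /=.
by rewrite -sqr_normc rmorphXn.
Qed.

Lemma normc_le_l2norm k (x : 'cV[C]_k) i : normc (x i 0) <= l2norm x.
Proof.
rewrite -(ger0_norm (normc_ge0 _)) -sqrtr_sqr ler_wsqrtr//.
by rewrite (bigD1 i)//= lerDl sumr_ge0// => j _; exact: sqr_ge0.
Qed.

Lemma normc_sum (I : Type) (s : seq I) (F : I -> C) :
  normc (\sum_(i <- s) F i) <= \sum_(i <- s) normc (F i).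
Proof.
elim/big_ind2: _ => [||//]; first by rewrite normc0.
by move=> x a y b xa yb; rewrite (le_trans (le_normcD _ _))// lerD.
Qed.

Lemma has_sup_opnorm k (A : 'M[C]_k) :
  has_sup [set l2norm (A *m x) | x in [set x : 'cV[C]_k | l2norm x <= 1]].
Proof.
split.
  by exists (l2norm (A *m 0)), 0 => //=; rewrite l2norm0 ler01.
exists (Num.sqrt (\sum_i (\sum_j normc (A i j)) ^+ 2)) => _ [x /= x1 <-].
rewrite ler_wsqrtr// ler_sum// => i _.
rewrite ler_sqr ?nnegrE ?normc_ge0 ?sumr_ge0// => [|j _];
  last exact: normc_ge0.
rewrite mxE (le_trans (normc_sum _ _))// ler_sum// => j _.
rewrite normcM ler_piMr ?normc_ge0//.
exact: le_trans (normc_le_l2norm _ _) x1.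
Qed.

Lemma has_sup_supnorm n (p : {mpoly C[n]}) :
  has_sup [set normc p.@[z] | z in @polydisc n].
Proof.
split.
  exists (normc p.@[fun=> 0]), (fun=> 0) => // i.
  by rewrite normc0 ler01.
exists (\sum_(m <- msupp p) normc p@_m) => _ [z /= z1 <-].
rewrite mevalE (le_trans (normc_sum _ _))// ler_sum// => m _.
rewrite normcM ler_piMr ?normc_ge0//.
elim/big_ind: _ => [|x y x1 y1|i _]; first by rewrite normc1.
  by rewrite normcM mulr_ile1 ?normc_ge0.
elim: (m i) => [|j IH]; first by rewrite expr0 normc1.
by rewrite exprS normcM mulr_ile1 ?normc_ge0.
Qed.

End Norms.

(* Main.v *)
Require Import Defs.
From mathcomp Require Import all_boot all_order all_algebra.
From mathcomp Require Import complex mpoly.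
From mathcomp Require Import classical_sets reals.
From mathcomp Require Import cyclic separable cyclotomic ring.

(** Commuting square-zero matrices of size 3 multiply to 0, because each has
    rank at most one.  Hence [p(A) = p(lam) + W] with
    [W = \sum_i d_i p(lam) N_i], again of square zero and therefore of the form
    [s e f^*] with [e], [f] orthonormal, and only the 2x2 Toeplitz matrix
    [[p(lam), 0], [s, p(lam)]] has to be bounded.  Put [b_i = <N_i f, e>], so
    that [s = \sum_i d_i p(lam) b_i]; compressing the contraction [A_i] to the
    span of [e] and [f] gives [|b_i| <= 1 - |lam_i|^2].  Thus there are
    holomorphic self-maps [phi_i] of the disc with [phi_i(0) = lam_i] and
    [phi_i'(0) = b_i], and [p(lam)], [s] are the first two Taylor coefficients
    of [p o phi], which is bounded by the sup norm of [p].  Replacing [phi_i] by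
    polynomials bounded by [1 + t], the Toeplitz bound follows from Parseval's
    identity on roots of unity. *)

Import Order.TTheory GRing.Theory Num.Theory.

Local Open Scope ring_scope.

Set Implicit Arguments.
Unset Strict Implicit.

(** * Parseval's identity and 2x2 Toeplitz matrices *)

Lemma closed_prim_root_exists (C : numClosedFieldType) n :
  (0 < n)%N -> exists z : C, n.-primitive_root z.
Proof.
move=> n_gt0; have [s Ds] := closed_field_poly_normal ('X^n - 1 : {poly C}).
have sz : size ('X^n - 1 : {poly C}) = n.+1 by rewrite size_XnsubC.
rewrite (monicP _) ?scale1r in Ds; last exact: monicXnsubC.
have us : uniq s.
  rewrite -separable_prod_XsubC -Ds separable_Xn_sub_1// pnatr_eq0 -lt0n//.
have /hasP[z _ zP] : has n.-primitive_root s.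
  apply: has_prim_root => //.
    by apply/allP => z; rewrite -root_prod_XsubC -Ds.
  by move: sz; rewrite Ds size_prod_XsubC => -[->].
by exists z.
Qed.

Lemma sum_expr_unity_root (F : fieldType) (z : F) n :
  z ^+ n = 1 -> z != 1 -> \sum_(j < n) z ^+ j = 0.
Proof.
move=> zn z1; apply: (mulfI (x := z - 1)); first by rewrite subr_eq0.
by rewrite mulr0 -subrX1 zn subrr.
Qed.

Lemma norm_unity_root (C : numClosedFieldType) n (z : C) :
  (0 < n)%N -> z ^+ n = 1 -> `|z| = 1.
Proof.
move=> n_gt0 zn; apply/eqP; rewrite -(pexpr_eq1 n_gt0)//.
by rewrite -normrX zn normr1.
Qed.

(** Orthogonality of the characters [j |-> w ^+ (j * k)]; the size bound keeps the exponents below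
    [n], so that distinct ones give distinct roots of unity. *)
Lemma parseval (C : numClosedFieldType) n (w : C) (g : {poly C}) :
  n.-primitive_root w -> (size g <= n)%N ->
  \sum_(j < n) `|g.[w ^+ j]| ^+ 2 = n%:R * \sum_(k < n) `|g`_k| ^+ 2.
Proof.
move=> wP gn; have n_gt0 := prim_order_gt0 wP.
have w1 := norm_unity_root n_gt0 (prim_expr_order wP).
have w0 : w != 0 by rewrite -normr_eq0 w1 oner_eq0.
have wc : w^* = w^-1 by rewrite invC_norm w1 expr1n invr1 mul1r.
have sumE (k l : 'I_n) :
    \sum_(j < n) (w ^+ j) ^+ k * ((w ^+ j) ^+ l)^* = n%:R * (k == l)%:R.
  transitivity (\sum_(j < n) (w ^+ k / w ^+ l) ^+ j).
    apply: eq_bigr => j _; rewrite !rmorphXn/= wc expr_div_n !exprVn.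
    by rewrite -!exprM (mulnC j k) (mulnC j l).
  have [->|kl] := eqVneq k l.
    rewrite divff ?expf_neq0// mulr1 (eq_bigr (fun=> 1)); last first.
      by move=> *; rewrite expr1n.
    by rewrite sumr_const card_ord.
  rewrite mulr0 sum_expr_unity_root//.
    rewrite expr_div_n -!exprM (mulnC k) (mulnC l) !exprM.
    by rewrite (prim_expr_order wP) !expr1n divr1.
  apply: contra kl => /eqP/(canRL (divfK (expf_neq0 l w0))); rewrite mul1r.
  by move/eqP; rewrite (eq_prim_root_expr wP) !modn_small.
under eq_bigr => j _.
  rewrite normCK (horner_coef_wide _ gn) rmorph_sum big_distrlr/=.
  over.
rewrite exchange_big/= mulr_sumr; apply: eq_bigr => k _.
rewrite exchange_big/= (bigD1 k)//= [X in _ + X]big1 => [|l lk].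
  under eq_bigr do rewrite rmorphM/= mulrACA.
  by rewrite -mulr_sumr sumE eqxx mulr1 addr0 mulrC -normCK.
under eq_bigr do rewrite rmorphM/= mulrACA.
by rewrite -mulr_sumr sumE eq_sym (negPf lk) !mulr0.
Qed.

(** With [h = c + d X], the left side collects the first two coefficients of [f * h]. Parseval
    bounds it by the mean of [|f h|^2] over roots of unity, where [|f| <= M], and a second use of
    Parseval evaluates the mean of [|h|^2]. *)
Lemma toeplitz2_le (C : numClosedFieldType) (f : {poly C}) (M c d : C) :
  0 <= M -> (forall z, `|z| = 1 -> `|f.[z]| <= M) ->
  `|f`_0 * c| ^+ 2 + `|f`_1 * c + f`_0 * d| ^+ 2
    <= M ^+ 2 * (`|c| ^+ 2 + `|d| ^+ 2).
Proof.
(* This order leaves room for both [h] and [f * h], and is at least 2, so that two coefficients can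
   be split off. *)
move=> M0 fM; pose h := c%:P + d *: 'X; pose n := (size f + 2)%N.
have n_gt0 : (0 < n)%N by rewrite /n addn2.
have [w wP] := closed_prim_root_exists C n_gt0.
have sh : (size h <= 2)%N.
  rewrite /h (leq_trans (size_polyD _ _))// geq_max size_polyC.
  by rewrite (leq_trans (size_scale_leq _ _)) ?size_polyX// andbT; case: eqP.
have hn : (size h <= n)%N by rewrite (leq_trans sh)// leq_addl.
have fhn : (size (f * h)%R <= n)%N.
  rewrite (leq_trans (size_polyMleq _ _))// /n.
  by rewrite (leq_trans (leq_pred _))// leq_add2l.
have h0 : h`_0 = c by rewrite /h !coefE mulr0 addr0.
have h1 : h`_1 = d by rewrite /h !coefE mulr1 add0r.
have hsum : \sum_(k < n) `|h`_k| ^+ 2 = `|c| ^+ 2 + `|d| ^+ 2.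
  rewrite /n addn2 !big_ord_recl/= h0 h1 big1 ?addr0// => k _.
  by rewrite nth_default ?normr0 ?expr0n// (leq_trans sh).
have le1 : `|f`_0 * c| ^+ 2 + `|f`_1 * c + f`_0 * d| ^+ 2
    <= \sum_(k < n) `|(f * h)`_k| ^+ 2.
  rewrite /n addn2 !big_ord_recl/= coef0M h0 coefM !big_ord_recl big_ord0/=.
  rewrite h0 h1 addr0 [f`_0 * d + _]addrC addrA lerDl sumr_ge0// => k _.
  by rewrite exprn_ge0.
have nn : 0 < n%:R :> C by rewrite ltr0n.
rewrite (le_trans le1)// -hsum -(ler_pM2l nn) mulrCA -!(parseval wP)//.
rewrite mulr_sumr.
apply: ler_sum => j _; rewrite hornerM normrM exprMn ler_wpM2r ?exprn_ge0//.
rewrite ler_pXn2r ?nnegrE// fM// normrX.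
by rewrite (norm_unity_root n_gt0 (prim_expr_order wP)) expr1n.
Qed.

(** * First-order jets of multivariate polynomials *)

(* Induction principle: [S] need not be commutative, so [mmap f h] need not be
   multiplicative. *)
Lemma mmap_rel n (R S : nzRingType) (f : {rmorphism R -> S}) (h : 'I_n -> S)
  (K : S -> {mpoly R[n]} -> Prop) :
  (forall c, K (f c) c%:MP) -> (forall i, K (h i) 'X_i) ->
  (forall x y p q, K x p -> K y q -> K (x + y) (p + q)) ->
  (forall x y p q, K x p -> K y q -> K (x * y) (p * q)) ->
  forall p, K (mmap f h p) p.
Proof.
move=> KC KX KD KM p; rewrite [p in K _ p]mpolyE /mmap.
have K1 : K 1 1 by have := KC 1; rewrite rmorph1.
apply: (big_ind2 K); [by have := KC 0; rewrite !rmorph0| |] => [*|m _].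
  exact: KD.
rewrite -mul_mpolyC; apply: (KM) => //; rewrite mpolyXE_id /mmap1.
apply: (big_ind2 K) => // [*|i _]; first exact: KM.
by elim: (m i) => [|k IH]; rewrite ?expr0// !exprS; apply: KM.
Qed.

Lemma mmap_horner n (R : comNzRingType) (phi : 'I_n -> {poly R}) p z :
  (mmap polyC phi p).[z] = p.@[fun i => (phi i).[z]].
Proof.
pose K (f : {poly R}) (q : {mpoly R[n]}) := f.[z] = q.@[fun i => (phi i).[z]].
apply: (mmap_rel (K := K)) => [c|i|x y q r Kx Ky|x y q r Kx Ky]; rewrite /K.
- by rewrite hornerC mevalC.
- by rewrite mevalXU.
- by rewrite hornerD mevalD Kx Ky.
- by rewrite hornerM mevalM Kx Ky.
Qed.

Section Grad.
Context (n : nat) (R : comNzRingType) (lam : 'I_n -> R).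
Implicit Types (p q : {mpoly R[n]}).

Lemma mderiv_polyX_eval i j : ('X_j : {mpoly R[n]})^`M(i).@[lam] = (i == j)%:R.
Proof.
rewrite mderivX mnm1E mevalZ eq_sym; have [->|_] := eqVneq i j.
  suff -> : (U_(j) - U_(j) = 0)%MM by rewrite mpolyX0 meval1 mulr1.
  by apply/mnmP => k; rewrite mnmBE subnn mnm0E.
by rewrite mul0r.
Qed.

(** Chain rule at the origin for [p] composed with [phi]. Both identities are proved together
    because the Leibniz rule for coefficient 1 involves coefficient 0. *)
Lemma mmap_coef01 (phi : 'I_n -> {poly R}) p :
  (forall i, (phi i)`_0 = lam i) ->
  (mmap polyC phi p)`_0 = p.@[lam] /\
  (mmap polyC phi p)`_1 = \sum_i p^`M(i).@[lam] * (phi i)`_1.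
Proof.
move=> phi0.
pose K (f : {poly R}) (q : {mpoly R[n]}) :=
  f`_0 = q.@[lam] /\ f`_1 = \sum_i q^`M(i).@[lam] * (phi i)`_1.
apply: (mmap_rel (K := K)) => [c|i|x y q r|x y q r]; rewrite /K.
- rewrite !coefC mevalC big1// => i _.
  by rewrite mderivC meval0 mul0r.
- rewrite phi0 mevalXU (bigD1 i)//= mderiv_polyX_eval eqxx mul1r.
  by rewrite big1 ?addr0// => j ji; rewrite mderiv_polyX_eval (negPf ji) mul0r.
- move=> [x0 x1] [y0 y1]; rewrite !coefD x0 x1 y0 y1 mevalD -big_split/=.
  by split=> //; apply: eq_bigr => i _; rewrite mderivD mevalD mulrDl.
- move=> [x0 x1] [y0 y1].
  rewrite coef0M coefM !big_ord_recl big_ord0/= x0 x1 y0 y1 mevalM addr0.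
  split=> //; rewrite mulr_sumr mulr_suml -big_split; apply: eq_bigr => i _ /=.
  by rewrite mderivM mevalD !mevalM; ring.
Qed.

(** The Taylor expansion stops at first order because all products of two nilpotent parts vanish. *)
Lemma mmap_jet k (N : 'I_n -> 'M[R]_k.+1) p :
  (forall i j, N i *m N j = 0) ->
  mmap (@scalar_mx R k.+1) (fun i => (lam i)%:M + N i) p
    = p.@[lam]%:M + \sum_i p^`M(i).@[lam] *: N i.
Proof.
move=> NN.
pose K (f : 'M[R]_k.+1) (q : {mpoly R[n]}) :=
  f = q.@[lam]%:M + \sum_i q^`M(i).@[lam] *: N i.
apply: (mmap_rel (K := K)) => [c|i|x y q r -> ->|x y q r -> ->]; rewrite /K.
- rewrite mevalC big1 ?addr0// => i _.
  by rewrite mderivC meval0 scale0r.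
- rewrite mevalXU (bigD1 i)//= mderiv_polyX_eval eqxx scale1r.
  rewrite big1 ?addr0// => j ji.
  by rewrite mderiv_polyX_eval (negPf ji) scale0r.
- rewrite mevalD raddfD/= addrACA -big_split/=; congr (_ + _).
  by apply: eq_bigr => i _; rewrite mderivD mevalD scalerDl.
- rewrite -mulmxE mulmxDl !mulmxDr !mul_scalar_mx mul_mx_scalar.
  rewrite [X in _ + (_ + X)](_ : _ = 0) ?addr0; last first.
    rewrite mulmx_suml big1// => i _; rewrite mulmx_sumr big1// => j _.
    by rewrite -scalemxAl -scalemxAr NN !scaler0.
  rewrite mevalM scale_scalar_mx -addrA !scaler_sumr -big_split/=.
  congr (_ + _); apply: eq_bigr => i _.
  by rewrite mderivM mevalD !mevalM !scalerA -scalerDl; congr (_ *: _); ring.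
Qed.

End Grad.

(** * Polynomials on slightly dilated polydiscs *)

Lemma expr1D_le (C : numDomainType) (t : C) d :
  0 <= t <= 1 -> (1 + t) ^+ d <= 1 + t * 2 ^+ d.
Proof.
(* This sharper bound is the chord of [(1 + t) ^+ d] over [[0, 1]]; it passes through the
   induction. *)
move=> /andP[t0 t1]; apply: (@le_trans _ _ (1 + t * (2 ^+ d - 1))); last first.
  by rewrite lerD2l ler_wpM2l// gerBl.
elim: d => [|d IH]; first by rewrite !expr0 subrr mulr0 addr0.
rewrite exprS (le_trans (ler_wpM2l _ IH)) ?addr_ge0//.
have -> : (1 + t) * (1 + t * (2 ^+ d - 1))
    = 1 + t * (2 ^+ d + t * (2 ^+ d - 1)).
  by ring.
rewrite lerD2l ler_wpM2l// exprS [2 * _]mulr_natl mulr2n -addrA lerD2l.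
by rewrite ler_piMl// subr_ge0 exprn_ege1// (ler_nat _ 1 2).
Qed.

(** Compare [z] with [y = z / (1 + t)] in the polydisc: a monomial of degree [d] changes by at most
    [(1 + t) ^+ d - 1 <= t * 2 ^+ d]. The constant [B] does not depend on [t]. *)
Lemma meval_norm_le_dilate n (C : numFieldType) (p : {mpoly C[n]}) (M : C) :
  (forall z, (forall i, `|z i| <= 1) -> `|p.@[z]| <= M) ->
  exists2 B, 0 <= B & forall t z, 0 <= t <= 1 ->
    (forall i, `|z i| <= 1 + t) -> `|p.@[z]| <= M + t * B.
Proof.
move=> pM; exists (\sum_(m <- msupp p) `|p@_m| * 2 ^+ mdeg m).
  by apply: sumr_ge0 => m _; rewrite mulr_ge0// exprn_ge0.
move=> t z t01 zt; have /andP[t0 _] := t01.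
have t1 : 0 < 1 + t by rewrite ltr_wpDr.
pose y i := z i / (1 + t).
have y1 i : `|y i| <= 1.
  by rewrite normrM normfV (gtr0_norm t1) ler_pdivrMr// mul1r.
have -> : p.@[z] = p.@[y] + (p.@[z] - p.@[y]) by rewrite addrC subrK.
rewrite (le_trans (ler_normD _ _))// lerD ?pM// !mevalE -sumrB mulr_sumr.
rewrite (le_trans (ler_norm_sum _ _ _))//; apply: ler_sum => m _.
rewrite -mulrBr normrM mulrCA ler_wpM2l//.
have -> : \prod_i z i ^+ m i = (1 + t) ^+ mdeg m * \prod_i y i ^+ m i.
  rewrite mdegE expr_sum -big_split/=; apply: eq_bigr => i _.
  by rewrite -exprMn mulrC divfK// gt_eqF.
rewrite -{2}[\prod_i _]mul1r -mulrBl normrM.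
have le1 : `|\prod_i y i ^+ m i| <= 1.
  rewrite normr_prod; apply: prodr_ile1 => i _.
  by rewrite normr_ge0 normrX exprn_ile1.
rewrite (le_trans (ler_wpM2l _ le1))// mulr1 ger0_norm.
  by rewrite lerBlDl expr1D_le.
by rewrite subr_ge0 exprn_ege1// lerDl.
Qed.

(** * Self-maps of the disc *)

Section DiscPoly.
Context (C : numClosedFieldType).

(** Möbius maps preserve the closed disc; the denominator is cleared since it may vanish when
    [|lam| = 1]. *)
Lemma mobius_norm_le (lam u : C) :
  `|lam| <= 1 -> `|u| <= 1 -> `|lam + u| <= `|1 + lam^* * u|.
Proof.
move=> l1 u1; rewrite -ler_sqr ?nnegrE// -subr_ge0.
have -> : `|1 + lam^* * u| ^+ 2 - `|lam + u| ^+ 2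
    = (1 - `|lam| ^+ 2) * (1 - `|u| ^+ 2).
  by rewrite !normCK !rmorphD !rmorphM/= conjCK rmorph1; ring.
by rewrite mulr_ge0// subr_ge0 exprn_ile1.
Qed.

(* Taylor truncation of [z |-> (lam + w z) / (1 + conj(lam) w z)]. *)
Definition mobius_trunc (lam w : C) K : {poly C} :=
  lam%:P +
  \sum_(k < K) ((1 - `|lam| ^+ 2) * w * (- lam^* * w) ^+ k) *: 'X^(k.+1).

Lemma mobius_trunc_coef0 lam w K : (mobius_trunc lam w K)`_0 = lam.
Proof.
rewrite coefD coefC coef_sum big1 ?addr0// => k _.
by rewrite coefZ coefXn mulr0.
Qed.

Lemma mobius_trunc_coef1 lam w K :
  (mobius_trunc lam w K.+1)`_1 = (1 - `|lam| ^+ 2) * w.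
Proof.
rewrite coefD coefC add0r coef_sum big_ord_recl coefZ coefXn !mulr1.
by rewrite big1 ?addr0// => k _; rewrite coefZ coefXn mulr0.
Qed.

(** Multiplication by the Möbius denominator [D] telescopes the geometric sum, leaving [lam + u] and
    a remainder. The factor [1 - |lam|^2 <= 2 (1 - |lam|) <= 2 |D|] of the remainder lets [|D|] be
    cancelled again. *)
Lemma mobius_trunc_horner_le lam w K z : `|lam| < 1 -> `|w| <= 1 -> `|z| <= 1 ->
  `|(mobius_trunc lam w K).[z]| <= 1 + 2 * `|lam| ^+ K.
Proof.
move=> l1 w1 z1; set f := mobius_trunc _ _ _; pose u := w * z.
have u1 : `|u| <= 1 by rewrite normrM mulr_ile1.
pose D := 1 + lam^* * u.
have D_ge : 1 - `|lam| <= `|D|.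
  have := lerB_normD 1 (lam^* * u); rewrite normr1 normrM norm_conjC.
  by apply: le_trans; rewrite lerD2l lerN2 ler_piMr.
have D_gt0 : 0 < `|D| by apply: lt_le_trans D_ge; rewrite subr_gt0.
have fD : f.[z] * D = lam + u - (1 - `|lam| ^+ 2) * u * (- lam^* * u) ^+ K.
  rewrite /f /mobius_trunc hornerD hornerC horner_sum.
  have -> : \sum_(k < K)
        (((1 - `|lam| ^+ 2) * w * (- lam^* * w) ^+ k) *: 'X^(k.+1)).[z]
      = (1 - `|lam| ^+ 2) * u * \sum_(k < K) (- lam^* * u) ^+ k.
    rewrite mulr_sumr; apply: eq_bigr => k _.
    by rewrite hornerZ hornerXn /u [z ^+ k.+1]exprS !exprMn; ring.
  have := subrX1 (- lam^* * u) K; set S := \sum_(k < K) _.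
  set v := (- _ * u) ^+ K.
  move=> vS; have -> : v = 1 + (- lam^* * u - 1) * S by rewrite -vS; ring.
  by rewrite /D normCK; ring.
rewrite -(ler_pM2r D_gt0) -normrM fD (le_trans (ler_normB _ _))//.
rewrite [leRHS]mulrDl mul1r lerD ?mobius_norm_le// ?(ltW l1)//.
have a_le : `|1 - `|lam| ^+ 2| <= 2 * `|D|.
  rewrite ger0_norm ?subr_ge0 ?exprn_ile1 ?(ltW l1)//.
  have -> : 1 - `|lam| ^+ 2 = (1 + `|lam|) * (1 - `|lam|) by ring.
  have l2 : 1 + `|lam| <= 2 by rewrite [2](natrD C 1 1) lerD2l ltW.
  by rewrite ler_pM// ?subr_ge0 ?(ltW l1)// addr_ge0.
have q_le : `|(- lam^* * u) ^+ K| <= `|lam| ^+ K.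
  rewrite normrX normrM normrN norm_conjC lerXn2r ?nnegrE ?mulr_ge0//.
  by rewrite ler_piMr.
rewrite normrM [`|_ * u|]normrM [leRHS]mulrAC ler_pM ?mulr_ge0//.
by apply: le_trans a_le; rewrite ler_piMr.
Qed.

End DiscPoly.

Lemma exists_expr_le (R : archiRealFieldType) (x t : R) :
  0 <= x -> x < 1 -> 0 < t -> exists K, x ^+ K.+1 <= t.
Proof.
move=> x0 x1 t0; have y0 : 0 < 1 - x by rewrite subr_gt0.
have /archi_boundP : 0 <= ((1 - x) * t)^-1 by rewrite invr_ge0 mulr_ge0// ltW.
set K := Num.bound _ => ltK; exists K.
(* Each of the [K.+1] terms of the geometric sum is at least [x ^+ K.+1]. *)
have xK : x ^+ K.+1 * K.+1%:R * (1 - x) <= 1.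
  have := subrX1 x K.+1; set S := \sum_(i < _) _ => ES.
  apply: (@le_trans _ _ (S * (1 - x))).
    rewrite ler_wpM2r ?(ltW y0)// mulr_natr -[X in _ *+ X]card_ord -sumr_const.
    by apply: ler_sum => i _; rewrite ler_wiXn2l ?(ltW x1)// ltnW.
  have -> : S * (1 - x) = 1 - x ^+ K.+1 by rewrite -[RHS]opprB ES; ring.
  by rewrite gerBl exprn_ge0.
have Kt : 1 <= t * (K.+1%:R * (1 - x)).
  have : ((1 - x) * t)^-1 <= K.+1%:R.
    by rewrite (le_trans (ltW ltK))// ler_nat.
  rewrite -[_^-1]mul1r ler_pdivrMr ?mulr_gt0//.
  by rewrite mulrC [X in X * _]mulrC -mulrA [X in _ * X]mulrC.
by rewrite -(ler_pM2r (mulr_gt0 (ltr0Sn R K) y0)) mulrA (le_trans xK).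
Qed.

Section Complex.
Context (R : realType).
Local Notation C := R[i].

(** A truncated Möbius map with [w = b / (1 - |lam|^2)] has this jet, and [t] absorbs the truncation
    error. When [|lam| = 1] the hypothesis forces [b = 0] and a constant serves. *)
Lemma disc_jet_poly (lam b t : C) :
  `|lam| <= 1 -> `|b| <= 1 - `|lam| ^+ 2 -> 0 < t ->
  exists phi : {poly C}, [/\ phi`_0 = lam, phi`_1 = b &
    forall z, `|z| <= 1 -> `|phi.[z]| <= 1 + t].
Proof.
rewrite le_eqVlt => /orP[/eqP l1|l1] bl t0.
  exists lam%:P; split=> [||z _]; rewrite ?coefC//=.
    by move: bl; rewrite l1 expr1n subrr normr_le0 => /eqP.
  by rewrite hornerC l1 lerDl ltW.
have a0 : 0 < 1 - `|lam| ^+ 2 by rewrite subr_gt0 exprn_ilt1.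
have [K leK] : exists K, 2 * `|lam| ^+ K.+1 <= t.
  (* Positivity in [C] makes [t] real, so the Archimedean argument can be run in [R]. *)
  have tR : t = (complex.Re t)%:C%C by rewrite RRe_real// gtr0_real.
  have [] := @exists_expr_le R (Normc.normc lam) (complex.Re t / 2).
  - exact: normc_ge0.
  - by rewrite -ltcR.
  - by rewrite divr_gt0// -ltcR -tR.
  move=> K leK; exists K.
  rewrite tR mulrC -ler_pdivlMr//.
  have : ((Normc.normc lam ^+ K.+1)%:C <= (complex.Re t / 2)%:C :> C)%C.
    by rewrite lecR.
  by rewrite rmorphXn/= rmorphM/= fmorphV/= rmorph_nat.
exists (mobius_trunc lam (b / (1 - `|lam| ^+ 2)) K.+1); split=> [||z z1].
- exact: mobius_trunc_coef0.
- by rewrite mobius_trunc_coef1 mulrC divfK// gt_eqF.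
- rewrite (le_trans (mobius_trunc_horner_le _ _ _ _))// ?lerD2l//.
  by rewrite normrM normfV (gtr0_norm a0) ler_pdivrMr// mul1r.
Qed.

(** For each [t] the Toeplitz bound applies to [p] composed with the polynomials of [disc_jet_poly].
    The left side depends only on their jets, hence not on [t], so [t] may tend to 0. *)
Lemma polydisc_jet_le n (lam b : 'I_n -> C) (p : {mpoly C[n]}) (M c d : C) :
  0 <= M ->
  (forall z, (forall i, `|z i| <= 1) -> `|p.@[z]| <= M) ->
  (forall i, `|lam i| <= 1) -> (forall i, `|b i| <= 1 - `|lam i| ^+ 2) ->
  `|p.@[lam] * c| ^+ 2
    + `|(\sum_i p^`M(i).@[lam] * b i) * c + p.@[lam] * d| ^+ 2
    <= M ^+ 2 * (`|c| ^+ 2 + `|d| ^+ 2).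
Proof.
move=> M0 pM l1 bl; have [B B0 pB] := meval_norm_le_dilate pM.
set L := (X in X <= _); set T := _ + `|d| ^+ 2.
have T0 : 0 <= T by rewrite addr_ge0// exprn_ge0.
have le_t t : 0 < t -> t <= 1 -> L <= (M + t * B) ^+ 2 * T.
  move=> t0 t1.
  have /fin_all_exists[phi phiP] i := disc_jet_poly (l1 i) (bl i) t0.
  have phi0 i : (phi i)`_0 = lam i by have [] := phiP i.
  have [f0 f1] := mmap_coef01 p phi0.
  rewrite /L -f0 (_ : \sum_i _ = (mmap polyC phi p)`_1).
    apply: toeplitz2_le => [|z z1]; first by rewrite addr_ge0// mulr_ge0// ltW.
    rewrite mmap_horner pB ?t1 ?ltW// => i.
    by have [_ _ ->] := phiP i; rewrite ?z1.
  by rewrite f1; apply: eq_bigr => i _; have [_ -> _] := phiP i.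
apply/ler_addgt0Pr => e e0.
pose X := (2 * M * B + B ^+ 2) * T.
have X0 : 0 <= X.
  by rewrite mulr_ge0// addr_ge0 ?exprn_ge0// mulr_ge0// mulr_ge0.
have D0 : 0 < e + X + 1 by rewrite ltr_wpDl// addr_ge0// ltW.
(* This choice gives both [t <= 1] and [t * X <= e]; since [t ^+ 2 <= t], the error in
   [(M + t * B) ^+ 2 * T] is at most [t * X]. *)
pose t := e / (e + X + 1).
have t0 : 0 < t by rewrite divr_gt0.
have t1 : t <= 1 by rewrite ler_pdivrMr// mul1r -addrA lerDl addr_ge0.
rewrite (le_trans (le_t t t0 t1))//.
apply: (@le_trans _ _ (M ^+ 2 * T + t * X)).
  rewrite -subr_ge0.
  have -> : M ^+ 2 * T + t * X - (M + t * B) ^+ 2 * T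
      = t * (1 - t) * (B ^+ 2 * T).
    by rewrite /X; move: (t) => s; ring.
  apply: mulr_ge0; last by rewrite mulr_ge0// exprn_ge0.
  by apply: mulr_ge0; rewrite ?subr_ge0// ltW.
rewrite lerD2l /t mulrAC ler_pdivrMr// ler_wpM2l ?(ltW e0)//.
by rewrite addrAC lerDr addr_ge0// ltW.
Qed.

End Complex.

(** * Square-zero matrices *)

Local Open Scope sesquilinear_scope.

Lemma rank1_factor (F : fieldType) m n (A : 'M[F]_(m, n)) :
  (\rank A <= 1)%N -> exists (u : 'cV_m) (v : 'rV_n), A = u *m v.
Proof.
rewrite leq_eqVlt ltnS leqn0 mxrank_eq0 => /orP[/eqP rA|/eqP->]; last first.
  by exists 0, 0; rewrite mul0mx.
rewrite -(mulmx_base A); move: (col_base A) (row_base A); rewrite rA => u v.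
by exists u, v.
Qed.

(** Sylvester's rank inequality gives [2 * \rank W <= 3]; this is where the size 3 enters. *)
Lemma sqr0_rank1_factor (F : fieldType) (W : 'M[F]_3) :
  W *m W = 0 -> exists (u : 'cV_3) (v : 'rV_3), W = u *m v.
Proof.
move=> WW; apply: rank1_factor; have := mxrank_mul_min W W.
by rewrite WW mxrank0; case: (\rank W) => [|[|r]]//; rewrite !addSn !addnS.
Qed.

(** A column of the commutation relation where [v] is nonzero shows that [u] is an eigenvector of
    [N], with eigenvalue 0 by nilpotency. Then [u v N = 0], and a row where [u] is nonzero gives
    [v N = 0]. *)
Lemma rank1_comm_nilp (F : fieldType) n (u : 'cV[F]_n) (v : 'rV[F]_n) N :
  u != 0 -> v != 0 -> N *m N = 0 -> N *m (u *m v) = u *m v *m N ->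
  N *m u = 0 /\ v *m N = 0.
Proof.
move=> u0 v0 NN comm.
have /rV0Pn[j vj] := v0; have /cV0Pn[i ui] := u0.
have mulE (a : 'cV[F]_n) (b : 'rV_n) p q : (a *m b) p q = a p 0 * b 0 q.
  by rewrite mxE big_ord1.
pose mu := (v *m N) 0 j / v 0 j.
have Nu : N *m u = mu *: u.
  apply/colP => k; have /matrixP/(_ k j) := comm.
  rewrite mulmxA -(mulmxA u) !mulE => /(canRL (mulfK vj)) ->.
  by rewrite [RHS]mxE /mu [RHS]mulrC mulrA.
have mu0 : mu = 0.
  have : N *m (N *m u) = 0 by rewrite mulmxA NN mul0mx.
  rewrite Nu -scalemxAr Nu scalerA => /eqP.
  by rewrite scaler_eq0 mulf_eq0 orbb (negPf u0) orbF => /eqP.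
have Nu0 : N *m u = 0 by rewrite Nu mu0 scale0r.
split=> //; apply/rowP => k; have /matrixP/(_ i k) := comm.
rewrite mulmxA Nu0 mul0mx -mulmxA mulE [_ i k]mxE => /esym/eqP.
by rewrite mulf_eq0 (negPf ui) [RHS]mxE => /eqP.
Qed.

Lemma comm_sqr0_mul0 (F : fieldType) (N M : 'M[F]_3) :
  N *m N = 0 -> M *m M = 0 -> N *m M = M *m N -> N *m M = 0.
Proof.
move=> NN MM comm; have [u [v ME]] := sqr0_rank1_factor MM.
have [u0|u0] := eqVneq u 0; first by rewrite ME u0 mul0mx mulmx0.
have [v0|v0] := eqVneq v 0; first by rewrite ME v0 !mulmx0.
rewrite ME in comm *; have [Nu _] := rank1_comm_nilp u0 v0 NN comm.
by rewrite mulmxA Nu mul0mx.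
Qed.

(** * Inner products and compression to an orthonormal pair *)

Section Dot.
Context (C : numClosedFieldType) (k : nat).
Implicit Types (x y z e f : 'cV[C]_k).

Definition dotc x y : C := (y ^t* *m x) 0 0.

Lemma dotcDl x y z : dotc (x + y) z = dotc x z + dotc y z.
Proof. by rewrite /dotc mulmxDr mxE. Qed.

Lemma dotcZl a x y : dotc (a *: x) y = a * dotc x y.
Proof. by rewrite /dotc -scalemxAr mxE. Qed.

Lemma dotc_suml (I : Type) (s : seq I) (x : I -> 'cV_k) y :
  dotc (\sum_(i <- s) x i) y = \sum_(i <- s) dotc (x i) y.
Proof. by rewrite /dotc mulmx_sumr summxE. Qed.

Lemma dotcC x y : dotc y x = (dotc x y)^*.
Proof.
rewrite /dotc !mxE rmorph_sum; apply: eq_bigr => i _.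
by rewrite !mxE rmorphM/= conjCK mulrC.
Qed.

Lemma dotcDr x y z : dotc z (x + y) = dotc z x + dotc z y.
Proof. by rewrite dotcC dotcDl rmorphD/= -!dotcC. Qed.

Lemma dotcZr a x y : dotc y (a *: x) = a^* * dotc y x.
Proof. by rewrite dotcC dotcZl rmorphM/= -dotcC. Qed.

Lemma dotcxx x : dotc x x = \sum_i `|x i 0| ^+ 2.
Proof. by rewrite /dotc mxE; apply: eq_bigr => i _; rewrite !mxE normCKC. Qed.

Lemma dotcxx_ge0 x : 0 <= dotc x x.
Proof. by rewrite dotcxx sumr_ge0// => i _; rewrite exprn_ge0. Qed.

Lemma dotcxx_gt0 x : x != 0 -> 0 < dotc x x.
Proof.
move=> /cV0Pn[i xi]; rewrite dotcxx (bigD1 i)//= ltr_pwDl//.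
  by rewrite exprn_gt0// normr_gt0.
by rewrite sumr_ge0// => j _; rewrite exprn_ge0.
Qed.

Definition orthonormal2 e f := [/\ dotc e e = 1, dotc f f = 1 & dotc e f = 0].

Section Orthonormal.
Context (e f : 'cV[C]_k) (ef : orthonormal2 e f).

Lemma orthonormal2_sym0 : dotc f e = 0.
Proof. by case: ef => _ _ h; rewrite dotcC h rmorph0. Qed.

Lemma dotc_pythagoras a b z : dotc z e = 0 -> dotc z f = 0 ->
  dotc (a *: e + b *: f + z) (a *: e + b *: f + z)
    = `|a| ^+ 2 + `|b| ^+ 2 + dotc z z.
Proof.
have fe := orthonormal2_sym0; have [ee ff e_f] := ef.
move=> ze zf; have ez : dotc e z = 0 by rewrite dotcC ze rmorph0.
have fz : dotc f z = 0 by rewrite dotcC zf rmorph0.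
rewrite !(dotcDl, dotcDr, dotcZl, dotcZr) fe ee ff e_f ze zf ez fz !normCK.
ring.
Qed.

Lemma dotc_decomp x : exists2 z,
  x = dotc x e *: e + dotc x f *: f + z & dotc z e = 0 /\ dotc z f = 0.
Proof.
have fe := orthonormal2_sym0; have [ee ff e_f] := ef.
exists (x + (- dotc x e) *: e + (- dotc x f) *: f).
  by rewrite !scaleNr -(addrA x) -opprD [RHS]addrC subrK.
by rewrite !(dotcDl, dotcZl) ee ff e_f fe; split; ring.
Qed.

Lemma bessel2 x : `|dotc x e| ^+ 2 + `|dotc x f| ^+ 2 <= dotc x x.
Proof.
have [z xE [ze zf]] := dotc_decomp x.
by rewrite {3 4}xE dotc_pythagoras// lerDl dotcxx_ge0.
Qed.

(** The operator acts on the span of [e] and [f] by the Toeplitz matrix and on the orthogonal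
    complement by the scalar [c0]; Pythagoras adds the two estimates. *)
Lemma jet_opnorm_le (c0 s M : C) (W : 'M[C]_k) :
  (forall x, W *m x = (s * dotc x f) *: e) ->
  (forall c d, `|c0 * c| ^+ 2 + `|s * c + c0 * d| ^+ 2
    <= M ^+ 2 * (`|c| ^+ 2 + `|d| ^+ 2)) ->
  forall x, dotc ((c0%:M + W) *m x) ((c0%:M + W) *m x) <= M ^+ 2 * dotc x x.
Proof.
move=> WE toep x; have [z xE [ze zf]] := dotc_decomp x.
move: (dotc x e) (dotc x f) xE (WE x) => a b xE Wx.
have -> : (c0%:M + W) *m x = (s * b + c0 * a) *: e + (c0 * b) *: f + c0 *: z.
  rewrite mulmxDl mul_scalar_mx Wx {1}xE !scalerDr !scalerA scalerDl.
  by rewrite addrC !addrA.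
rewrite xE !dotc_pythagoras// ?dotcZl ?ze ?zf ?mulr0//.
rewrite dotcZr mulrDr lerD//; first by rewrite addrC (addrC (`|a| ^+ 2)).
rewrite mulrA -normCK ler_wpM2r ?dotcxx_ge0//.
(* This instance yields [|c0| ^+ 2 <= M ^+ 2], as required on the complement. *)
have := toep 0 1; rewrite !mulr0 normr0 normr1 add0r mulr1 expr1n.
by rewrite expr0n /= !add0r mulr1.
Qed.

(** The compression to the span of [e] and [f] is upper triangular with diagonal [lam, lam] and
    corner [b], and is again a contraction by Bessel's inequality. *)
Lemma contraction_jet_le (lam : C) (N : 'M[C]_k) :
  N *m e = 0 -> f ^t* *m N = 0 ->
  (forall x, dotc ((lam%:M + N) *m x) ((lam%:M + N) *m x) <= dotc x x) ->
  `|lam| <= 1 /\ `|dotc (N *m f) e| <= 1 - `|lam| ^+ 2.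
Proof.
move=> Ne fN contr; set b := dotc (N *m f) e.
have fe := orthonormal2_sym0; have [ee ff e_f] := ef.
have Nff : dotc (N *m f) f = 0 by rewrite /dotc mulmxA fN mul0mx mxE.
have key c d : `|lam * d + c * b| ^+ 2 + `|lam * c| ^+ 2
    <= `|d| ^+ 2 + `|c| ^+ 2.
  pose x := d *: e + c *: f.
  have : dotc x x = `|d| ^+ 2 + `|c| ^+ 2.
    by rewrite !(dotcDl, dotcDr, dotcZl, dotcZr) fe ee ff e_f !normCK; ring.
  move=> <-; apply: le_trans (contr x); apply: le_trans (bessel2 _).
  have -> : (lam%:M + N) *m x = (lam * d) *: e + (lam * c) *: f + c *: (N *m f).
    rewrite mulmxDl mul_scalar_mx [N *m _]mulmxDr -!scalemxAr Ne scaler0 add0r.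
    by rewrite scalerDr !scalerA.
  rewrite !(dotcDl, dotcZl) fe ee ff e_f Nff -/b.
  by rewrite !(mulr0, mulr1, addr0, add0r).
have l1 : `|lam| <= 1.
  have := key 0 1; rewrite !(mulr0, mulr1, mul0r, addr0, normr0, normr1).
  by rewrite expr1n expr0n/= !addr0 expr_le1.
split=> //; have a0 : 0 <= 1 - `|lam| ^+ 2 by rewrite subr_ge0 exprn_ile1.
(* These coefficients make [lam * d + c * b] equal to [b]; the inequality becomes [a |b|^2 <= a^3]
   with [a = 1 - |lam|^2]. If [a = 0], the vector [f] gives [b = 0] instead. *)
have := key (1 - `|lam| ^+ 2) (lam^* * b).
have := a0; rewrite le_eqVlt => /orP[/eqP a_eq|a_gt0] h.
  have := key 1 0; rewrite !(mulr0, mulr1, mul1r, add0r, normr0, normr1).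
  rewrite expr1n expr0n/= add0r -a_eq -lerBrDr -a_eq.
  by rewrite -normrX normr_le0 expf_eq0/= => /eqP ->; rewrite normr0.
move: h; have -> : lam * (lam^* * b) + (1 - `|lam| ^+ 2) * b = b.
  by rewrite normCK; ring.
rewrite !normrM norm_conjC (ger0_norm a0) !exprMn addrC -lerBrDr => h.
have : (1 - `|lam| ^+ 2) * `|b| ^+ 2
    <= (1 - `|lam| ^+ 2) * (1 - `|lam| ^+ 2) ^+ 2.
  rewrite -subr_ge0; move: h; rewrite -subr_ge0.
  by congr (is_true (0 <= _)); ring.
by rewrite ler_pM2l// ler_sqr ?nnegrE.
Qed.

End Orthonormal.

(** Normalise [u] and the adjoint of [v]; [s] is the product of their lengths, and [v u = 0] is
    their orthogonality. *)
Lemma sqr0_rank1_normal_form (u : 'cV[C]_k) (v : 'rV[C]_k) :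
  u != 0 -> v != 0 -> v *m u = 0 ->
  exists e f (s : C), [/\ orthonormal2 e f,
    forall x, (u *m v) *m x = (s * dotc x f) *: e,
    forall N : 'M_k, N *m u = 0 -> N *m e = 0 &
    forall N : 'M_k, v *m N = 0 -> f ^t* *m N = 0].
Proof.
move=> u0 v0 vu.
have vt0 : v ^t* != 0.
  by apply: contra v0 => /eqP h; rewrite -[v]trmxCK h !(map_mx0, trmx0).
pose nu := sqrtC (dotc u u); pose nv := sqrtC (dotc (v ^t*) (v ^t*)).
have nu_gt0 : 0 < nu by rewrite sqrtC_gt0 dotcxx_gt0.
have nv_gt0 : 0 < nv by rewrite sqrtC_gt0 dotcxx_gt0.
have normalize x : x != 0 -> let n := sqrtC (dotc x x) in
    dotc (n^-1 *: x) (n^-1 *: x) = 1.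
  move=> x0 n; have n0 : 0 < n by rewrite sqrtC_gt0 dotcxx_gt0.
  rewrite dotcZl dotcZr conj_Creal ?gtr0_real ?invr_gt0// mulrA -expr2.
  by rewrite exprVn sqrtCK mulVf// gt_eqF// dotcxx_gt0.
have nvr : nv^-1^* = nv^-1 by rewrite conj_Creal// gtr0_real// invr_gt0.
exists (nu^-1 *: u), (nv^-1 *: v ^t*), (nu * nv); split.
- split; [exact: normalize | exact: normalize |].
  by rewrite dotcZl dotcZr /dotc trmxCK vu mxE !mulr0.
- move=> x; rewrite dotcZr nvr -mulmxA [v *m x]mx11_scalar.
  rewrite mul_mx_scalar scalerA.
  rewrite /dotc trmxCK; congr (_ *: _); move: (_ 0 0) => a.
  by field; rewrite !gt_eqF.
- by move=> N Nu; rewrite -scalemxAr Nu scaler0.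
- move=> N vN; rewrite -[_ ^t*]/(_ ^t*) linearZ/= map_mxZ/= trmxCK nvr.
  by rewrite -scalemxAl vN scaler0.
Qed.

End Dot.

Lemma sqr0_ker_neq0 (F : fieldType) k (N : 'M[F]_k.+1) :
  N *m N = 0 -> exists2 x : 'cV_k.+1, x != 0 & N *m x = 0.
Proof.
move=> NN; have [N0|/matrix0Pn[i [j Nij]]] := eqVneq N 0.
  exists (delta_mx 0 0); last by rewrite N0 mul0mx.
  by apply/cV0Pn; exists 0; rewrite mxE !eqxx oner_neq0.
exists (col j N); last by rewrite colE mulmxA NN mul0mx.
by apply/cV0Pn; exists i; rewrite mxE.
Qed.

(** Every [N i] commutes with [W = u v], both products being 0, so it kills [u] and is killed by
    [v]. Thus one pair [e], [f] serves all indices, and [s] is read off as the entry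
    [dotc (W *m f) e]. *)
Lemma jet_sum_normal_form (C : numClosedFieldType) n (c : 'I_n -> C)
  (N : 'I_n -> 'M[C]_3) (W := \sum_i c i *: N i) :
  (forall i j, N i *m N j = 0) -> W != 0 ->
  exists e f s, [/\ orthonormal2 e f, forall x, W *m x = (s * dotc x f) *: e,
    forall i, N i *m e = 0 /\ f ^t* *m N i = 0 &
    s = \sum_i c i * dotc (N i *m f) e].
Proof.
move=> NN W0.
have NW i : N i *m W = 0.
  by rewrite mulmx_sumr big1// => j _; rewrite -scalemxAr NN scaler0.
have WN i : W *m N i = 0.
  by rewrite mulmx_suml big1// => j _; rewrite -scalemxAl NN scaler0.
have WW : W *m W = 0.
  by rewrite {1}/W mulmx_suml big1// => i _; rewrite -scalemxAl NW scaler0.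
have [u [v WE]] := sqr0_rank1_factor WW.
have u0 : u != 0 by apply: contraNneq W0 => u0; rewrite WE u0 mul0mx.
have v0 : v != 0 by apply: contraNneq W0 => v0; rewrite WE v0 mulmx0.
have vu : v *m u = 0.
  (* Applied to [W] itself, [rank1_comm_nilp] gives [W u = (v u) u = 0]. *)
  have comm : W *m (u *m v) = u *m v *m W by rewrite -WE.
  have [/eqP + _] := rank1_comm_nilp u0 v0 WW comm.
  rewrite WE -mulmxA [v *m u]mx11_scalar mul_mx_scalar.
  rewrite scaler_eq0 (negPf u0) orbF.
  by move=> /eqP ->; rewrite raddf0.
have [e [f [s [ef WE' Ne fN]]]] := sqr0_rank1_normal_form u0 v0 vu.
have Ws x : W *m x = (s * dotc x f) *: e by rewrite WE WE'.
exists e, f, s; split=> // [i|].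
  have comm : N i *m (u *m v) = u *m v *m N i by rewrite -WE NW WN.
  have [Nu vN] := rank1_comm_nilp u0 v0 (NN i i) comm.
  by split; [apply: Ne | apply: fN].
have [ee ff _] := ef.
have : dotc (W *m f) e = s by rewrite Ws ff mulr1 dotcZl ee mulr1.
rewrite /W mulmx_suml dotc_suml => <-; apply: eq_bigr => i _.
by rewrite -scalemxAl dotcZl.
Qed.

(** * Operator norm and supremum norm *)

Section Norms.
Context (R : realType).
Local Notation C := R[i].

Lemma l2norm_ge0 k (x : 'cV[C]_k) : 0 <= l2norm x.
Proof. exact: sqrtr_ge0. Qed.

(** Bridge from the [R]-valued norms to the [C]-valued inner product used in the estimates. *)
Lemma l2norm_dotc k (x : 'cV[C]_k) : ((l2norm x ^+ 2)%:C)%C = dotc x x.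
Proof.
rewrite dotcxx sqr_sqrtr ?sumr_ge0// => [|i _]; last exact: sqr_ge0.
by rewrite rmorph_sum; apply: eq_bigr => i _; rewrite rmorphXn.
Qed.

Lemma l2normZ k (a : C) (x : 'cV[C]_k) :
  l2norm (a *: x) = Normc.normc a * l2norm x.
Proof.
apply/eqP; rewrite -(eqrXn2 (n := 2)) ?mulr_ge0 ?normc_ge0 ?l2norm_ge0//.
apply/eqP/(@complexI R); rewrite l2norm_dotc exprMn rmorphM/= l2norm_dotc.
by rewrite dotcZl dotcZr mulrA -normCK rmorphXn.
Qed.

Lemma l2norm_eq0 k (x : 'cV[C]_k) : l2norm x = 0 -> x = 0.
Proof.
move=> x0; apply/eqP; apply: contraTT isT => /dotcxx_gt0.
by rewrite -l2norm_dotc x0 expr0n ltxx.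
Qed.

Lemma l2norm_mul_le_opnorm k (A : 'M[C]_k) x :
  l2norm (A *m x) <= opnorm A * l2norm x.
Proof.
have [->|x0] := eqVneq x 0; first by rewrite mulmx0 l2norm0 mulr0.
have nx : 0 < l2norm x.
  by rewrite lt_def l2norm_ge0 andbT; apply: contra_neq x0; exact: l2norm_eq0.
pose a : C := ((l2norm x)^-1)%:C%C.
have na : Normc.normc a = (l2norm x)^-1.
  by apply: (@complexI R); rewrite -[LHS]/(`|a|) ger0_norm// ler0c invr_ge0 ltW.
rewrite -ler_pdivrMr// mulrC -na -l2normZ scalemxAr.
apply: (sup_upper_bound (has_sup_opnorm A)); exists (a *: x) => //=.
by rewrite l2normZ na mulVf// gt_eqF.
Qed.

Lemma contraction_dotc k (A : 'M[C]_k) x :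
  contraction A -> dotc (A *m x) (A *m x) <= dotc x x.
Proof.
move=> A1; rewrite -!l2norm_dotc lecR ler_sqr ?nnegrE ?l2norm_ge0//.
apply: le_trans (l2norm_mul_le_opnorm _ _) _.
by rewrite ler_piMl// l2norm_ge0.
Qed.

Lemma opnorm_le k (A : 'M[C]_k) (M : R) : 0 <= M ->
  (forall x, dotc (A *m x) (A *m x) <= M%:C%C ^+ 2 * dotc x x) -> opnorm A <= M.
Proof.
move=> M0 AM; apply: ge_sup; first by have [] := has_sup_opnorm A.
move=> _ [x /= x1 <-].
have := AM x; rewrite -!l2norm_dotc -rmorphXn -rmorphM/= lecR -exprMn.
rewrite ler_sqr ?nnegrE ?mulr_ge0 ?l2norm_ge0// => /le_trans; apply.
by rewrite ler_piMr.
Qed.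

Lemma meval_le_supnorm n (p : {mpoly C[n]}) (z : 'I_n -> C) :
  (forall i, `|z i| <= 1) -> `|p.@[z]| <= (supnorm p)%:C%C.
Proof.
move=> z1; rewrite lecR; apply: (sup_upper_bound (has_sup_supnorm p)).
by exists z => // i; have := z1 i; rewrite lecR.
Qed.

Lemma supnorm_ge0 n (p : {mpoly C[n]}) : 0 <= supnorm p.
Proof.
rewrite -ler0c; have /le_trans := normr_ge0 p.@[fun=> 0]; apply.
by apply: meval_le_supnorm => i; rewrite normr0.
Qed.

End Norms.

(** * The von Neumann inequality *)

Unset Implicit Arguments.

Theorem proposition3p2 (R : realType) (n : nat) (hn : (1 <= n)%N)
  (A : 'I_n -> 'M[R[i]]_3)
  (hcomm : forall i j, A i *m A j = A j *m A i)
  (hcontr : forall i, contraction (A i))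
  (hform : forall i, scalar_plus_nilpotent2 (A i))
  (p : {mpoly R[i][n]}) :
  opnorm (mxeval p A) <= supnorm p.
Proof.
have /fin_all_exists[lam] := hform; move=> /fin_all_exists[N NP].
have AE i : A i = (lam i)%:M + N i by have [] := NP i.
have NN0 i : N i *m N i = 0 by have [] := NP i.
have comm i j : N i *m N j = N j *m N i.
  have NE l : N l = A l - (lam l)%:M by rewrite AE addrC addKr.
  rewrite !NE; apply: comm_mxB; last exact: comm_mx_scalar.
  by apply/comm_mx_sym/comm_mxB; [exact: hcomm | exact: comm_mx_scalar].
have NN i j : N i *m N j = 0 by apply: comm_sqr0_mul0.
have Acontr i x :
    dotc (((lam i)%:M + N i) *m x) (((lam i)%:M + N i) *m x) <= dotc x x.
  by rewrite -AE contraction_dotc.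
have lam1 i : `|lam i| <= 1.
  (* A kernel vector of [N i] is an eigenvector of [A i] with eigenvalue [lam i]. *)
  have [x x0 Nx] := sqr0_ker_neq0 (NN0 i).
  have := Acontr i x.
  rewrite mulmxDl Nx addr0 mul_scalar_mx dotcZl dotcZr mulrA.
  by rewrite -normCK ger_pMl ?dotcxx_gt0// expr_le1.
apply: opnorm_le => [|x]; first exact: supnorm_ge0.
have -> : mxeval p A = p.@[lam]%:M + \sum_i p^`M(i).@[lam] *: N i.
  rewrite -mmap_jet//; apply: eq_bigr => m _; congr (_ * _).
  exact: mmap1_eq.
have M0 : 0 <= (supnorm p)%:C%C by rewrite ler0c supnorm_ge0.
have pM := meval_le_supnorm p.
(* A vanishing nilpotent part provides no pair [e], [f]; then the matrix is the scalar
   [p.@[lam]]. *)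
have [->|W0] := eqVneq (\sum_i p^`M(i).@[lam] *: N i) 0.
  rewrite addr0 mul_scalar_mx dotcZl dotcZr mulrA -normCK.
  by rewrite ler_wpM2r ?dotcxx_ge0// ler_sqr ?nnegrE// pM.
have [e [f [s [ef Ws NP' sE]]]] := jet_sum_normal_form NN W0.
apply: (jet_opnorm_le ef Ws) => c d; rewrite sE.
apply: polydisc_jet_le => // i; have [Ne fN] := NP' i.
by have [] := contraction_jet_le ef Ne fN (Acontr i).
Qed.
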